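(* Let $F\in\mathbb{F}$ and suppose that only two options (''worse'' and ''better'') are allowed in the comparisons. Let $W_{i,j}$ ($1\le i,j\le n$, $i\neq j$) be the non-negative integer number of judgments according to which object $i$ is ''better'' than object $j$ (equivalently, $j$ is ''worse'' than $i$). Fix $m_1=0$. Then the likelihood function $$L(m_1,\dots,m_n)=\prod_{i\neq j} F(m_i-m_j)^{W_{i,j}}$$ attains its maximal value over $(m_2,\dots,m_n)\in\mathbb{R}^{n-1}$ and its maximizer is unique if and only if the following condition holds: for every partition of the set of objects $\{1,\dots,n\}$ into two non-empty subsets $S$ and $\overline{S}$, there exist $i\in S$ and $j\in\overline{S}$ with $W_{i,j}>0$, and there exist $i'\in S$ and $j'\in\overline{S}$ with $W_{j',i'}>0$.
   Context: There are $n$ objects labelled $1,\dots,n$, with latent random variables $\xi_1,\dots,\xi_n$, $E(\xi_i)=m_i$, and $\xi_i-\xi_j=m_i-m_j+\eta_{i,j}$ for $i\ne j$, where the $\eta_{i,j}$ are identically distributed with expectation $0$ and common cumulative distribution function (c.d.f.) $F$. In the two-option model, $i$ is judged ''worse'' than $j$ when $\xi_i-\xi_j<0$, with probability $F(-(m_i-m_j))$, and ''better'' otherwise, with probability $1-F(-(m_i-m_j))=F(m_i-m_j)$. Judgments are assumed independent, and the parameters are estimated by maximum likelihood. $\mathbb{F}$ denotes the set of c.d.f.'s $F$ such that $0<F(x)<1$ for all $x\in\mathbb{R}$, $F$ is three times continuously differentiable, its probability density function $f=F'$ is symmetric ($f(-x)=f(x)$), and $\log f$ is a strictly concave function on $\mathbb{R}$.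 *)

(* Defs.v *)
From HB Require Import structures.
From mathcomp Require Export all_boot all_order all_algebra.
From mathcomp Require Export all_classical all_reals all_analysis.
Export Order.TTheory GRing.Theory Num.Theory.
Export numFieldNormedType.Exports.

Set Implicit Arguments.
Unset Strict Implicit.
Unset Printing Implicit Defensive.

Local Open Scope ring_scope.
Local Open Scope classical_set_scope.

(* [cdf X] takes values in \bar R, hence the injection [%:E]. *)
Definition is_cdf (R : realType) (F : R -> R) : Prop :=
  exists (d : measure_display) (T : measurableType d) (P : probability T R)
    (X : {RV P >-> R}), forall x : R, cdf X x = (F x)%:E.

Definition continuously_differentiable (R : realType) (k : nat) (F : R -> R)
    : Prop :=
  (forall (j : nat) (x : R), (j < k)%N -> derivable (F^`(j)) x 1) /\
  continuous (F^`(k)).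

Definition strictly_concave (R : realType) (g : R -> R) : Prop :=
  forall x y t : R, x != y -> 0 < t < 1 ->
    t * g x + (1 - t) * g y < g (t * x + (1 - t) * y).

(* The library's [ln] is 0 on nonpositive reals, so that [log f] be defined on
   the whole line is recorded by the separate clause on positivity of f. *)
Definition cdf_class (R : realType) (F : R -> R) : Prop :=
  [/\ is_cdf F,
      forall x : R, 0 < F x < 1,
      continuously_differentiable 3 F,
      forall x : R, F^`() (- x) = F^`() x &
      (forall x : R, 0 < F^`() x) /\
      strictly_concave (fun x : R => ln (F^`()%classic x))].

(* Diagonal entries of W play no role. *)
Definition likelihood (R : realType) (F : R -> R) (n : nat)
    (W : 'I_n -> 'I_n -> nat) (m : 'rV[R]_n) : R :=
  \prod_(i < n) \prod_(j < n | i != j) F (m ord0 i - m ord0 j) ^+ W i j.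

(* The objects are indexed by 'I_n.+1, the first one being [ord0], so that the
   normalization of the first parameter makes sense. *)
Definition is_likelihood_maximizer (R : realType) (F : R -> R) (n : nat)
    (W : 'I_n.+1 -> 'I_n.+1 -> nat) (m : 'rV[R]_n.+1) : Prop :=
  m ord0 ord0 = 0 /\
  forall m' : 'rV[R]_n.+1, m' ord0 ord0 = 0 ->
    likelihood F W m' <= likelihood F W m.

(* Main.v *)
(* Strict log-concavity passes from the density to the c.d.f. [F], so [log L] is
   strictly concave along any direction changing some [m i - m j] with
   [W i j > 0]; when every cut is crossed by such a pair the maximizer is
   therefore unique. It exists because [L 0 <= L m] bounds [m i - m j] below
   whenever [W i j > 0], hence, chaining along paths, bounds every difference.
   Conversely, if [W i j = 0] for all [i] in [S] and [j] outside, lowering the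
   block [S] does not decrease [L], which contradicts uniqueness. *)
Require Import Defs.
From mathcomp Require Import lra.

Set Implicit Arguments.
Unset Strict Implicit.
Unset Printing Implicit Defensive.

Local Open Scope ring_scope.

(** * Tail and monotonicity of the c.d.f *)

(** The left tail serves twice: as the boundary value in the log-concavity argument, and to make the
    likelihood small when a linked gap is very negative. *)
Lemma cdf_class_nearNy (R : realType) (F : R -> R) :
  cdf_class F -> forall e : R, 0 < e -> exists x, F x < e.
Proof.
case=> -[d [T [P [X XF]]]] _ _ _ _ e e0.
have := cvg_cdfNy0 X => /fine_cvgP[_] /cvgr0Pnorm_lt /(_ _ e0) [M [Mr MP]].
exists (M - 1); have /= := MP (M - 1).
by rewrite XF /= => /(_ ltac:(lra)); apply: le_lt_trans; exact: ler_norm.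
Qed.

Lemma cdf_class_derivable (R : realType) (F : R -> R) :
  cdf_class F -> forall x : R, derivable F x 1.
Proof. by case=> _ _ [dF _] _ _ x; have := dF 0%N x isT; rewrite derive1n0. Qed.

Lemma derive1_gt0_lt (R : realType) (G : R -> R) (a b : R) :
    (forall x : R, derivable G x 1) ->
    (forall x : R, a < x < b -> 0 < (G^`()%classic x)) -> a < b ->
  G a < G b.
Proof.
move=> dG G'0 ab; apply: (@gtr0_derive1_lt_cc _ G a b) => //.
- by apply: derivable_within_continuous => x _; exact: dG.
- by rewrite in_itv /= lexx ltW.
- by rewrite in_itv /= lexx ltW.
Qed.

Lemma cdf_class_homo_lt (R : realType) (F : R -> R) :
  cdf_class F -> {homo F : x y / x < y}.
Proof.
move=> hF x y; apply: derive1_gt0_lt => [|z _]; first exact: cdf_class_derivable.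
by case: hF => _ _ _ _ [].
Qed.

(** * Strict log-concavity, from the density to the c.d.f *)

(** The points [s] and [t - h] are convex combinations of [s - h] and [t] with swapped weights [l]
    and [1 - l]; the two concavity inequalities add up. *)
Lemma strictly_concave_exchange (R : realType) (g : R -> R) (s t h : R) :
  strictly_concave g -> s < t -> 0 < h ->
  g (s - h) + g t < g s + g (t - h).
Proof.
move=> gc st h0.
have D0 : 0 < t - s + h by lra.
have neq : s - h != t by rewrite lt_eqF//; lra.
set l := (t - s) / (t - s + h).
have l01 : 0 < l < 1.
  by rewrite /l divr_gt0 ?ltr_pdivrMr ?mul1r ?subr_gt0//=; lra.
have lD : l * (t - s + h) = t - s by rewrite /l divfK// gt_eqF.
have := gc (s - h) t l neq l01.
have := gc (s - h) t (1 - l) neq ltac:(lra).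
have -> : l * (s - h) + (1 - l) * t = s by rewrite -[RHS]addr0; lra.
have -> : (1 - l) * (s - h) + (1 - (1 - l)) * t = t - h by lra.
lra.
Qed.

Lemma ln_strictly_concave_exchange (R : realType) (f : R -> R) (s t h : R) :
    (forall x, 0 < f x) -> strictly_concave (fun x => ln (f x)) ->
    s < t -> 0 < h ->
  f (s - h) * f t < f s * f (t - h).
Proof.
move=> f0 fc st h0; rewrite -ltr_ln ?posrE ?mulr_gt0// !lnM ?posrE//.
exact: (@strictly_concave_exchange _ (fun x => ln (f x))).
Qed.

(* The exchange inequality makes [f (t - h) / f t] increasing in [t]; comparing
   it with its value [c] at [t = z], integration over [`]-oo, z]] gives
   [F (z - h) < c * F z], and integration over [`[z, z + h]] gives
   [c * (F (z + h) - F z) < F z - F (z - h)]. *)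
Lemma cdf_class_log_concave (R : realType) (F : R -> R) (z h : R) :
  cdf_class F -> 0 < h -> F (z - h) * F (z + h) < F z ^+ 2.
Proof.
move=> hF h0.
have dF := cdf_class_derivable hF; have Flt := cdf_class_homo_lt hF.
have F0 := cdf_class_nearNy hF.
case: hF => _ F01 _ _ []; set f := F^`()%classic => f0 fc.
have exch (s t : R) : s < t -> f (s - h) * f t < f s * f (t - h).
  by move=> st; exact: ln_strictly_concave_exchange.
set c := f (z - h) / f z.
have c0 : 0 < c by rewrite divr_gt0.
have cz : c * f z = f (z - h) by rewrite divfK// gt_eqF.
(* Monotonicity of [G] replaces integration: by [exch] against [z], its derivative is positive
   before [z] and negative after. *)
pose G := fun t => c * F t - F (t - h).
have dFE (t : R) : is_derive t (1 : R) F (f t).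
  by rewrite /f derive1E; apply: DeriveDef.
have isG (t : R) : is_derive t (1 : R) G (c * f t - f (t - h)).
  have dcF : is_derive t (1 : R) (c \*: F) (c *: f t) by exact: is_deriveZ.
  have dFh : is_derive t (1 : R) (F \o (fun u : R => u - h)) (f (t - h)).
    rewrite -[X in is_derive _ _ _ X]mulr1.
    apply: is_derive1_comp.
    rewrite -[X in is_derive _ _ _ X](subr0 1).
    exact: is_deriveB.
  exact: is_deriveB dcF dFh.
have dG (t : R) : derivable G t 1 by case: (isG t).
have G'E (t : R) : G^`()%classic t = c * f t - f (t - h).
  by rewrite derive1E derive_val.
have Gincr (s t : R) : s < t -> t <= z -> G s < G t.
  move=> st tz; apply: derive1_gt0_lt => // x /andP[_ xt]; rewrite G'E subr_gt0.
  have /exch : x < z by lra.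
  by rewrite -(ltr_pM2r (f0 z)) mulrAC cz; nra.
have Gdecr : G (z + h) < G z.
  rewrite -ltrN2; apply: (@derive1_gt0_lt _ (- G)) => [x|x /andP[zx _]|].
  - exact: derivableN.
  - rewrite derive1E deriveN// -derive1E G'E oppr_gt0 subr_lt0.
    have := exch _ _ zx.
    by rewrite -(ltr_pM2r (f0 z)) mulrAC cz; nra.
  - by lra.
have Gz : 0 < G z.
  (* Otherwise [G (z - 1) < 0], and [G] would stay below this value further left, whereas
     [G v > - F (v - h)] is arbitrarily close to 0 from below. *)
  rewrite ltNge; apply/negP => Gz0.
  have Gz1 : G (z - 1) < 0 by apply: lt_le_trans Gz0; apply: Gincr; lra.
  have [w Fw] := F0 (- G (z - 1)) ltac:(lra).
  pose v := Num.min (z - 2) w.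
  have vz : v <= z - 2 by rewrite ge_min lexx.
  have vw : v <= w by rewrite ge_min lexx orbT.
  have : G v < G (z - 1) by apply: Gincr; lra.
  have : F (v - h) < F w by apply: Flt; lra.
  have /andP[] := F01 v.
  rewrite {1}/G; nra.
have Fz : F (z - h) < F z by apply: Flt; lra.
have /andP[Fz0 _] := F01 z.
have /andP[Fh0 _] := F01 (z - h).
move: Gz Gdecr; rewrite /G addrK => Gz Gdecr.
(* With [a = F (z - h)] and [b = F z], [Gdecr] times [a] reduces the goal to
   [0 < (c * b - a) * (b - a)], positive by [Gz] and [Fz]. *)
rewrite -(ltr_pM2l c0).
nra.
Qed.

(** * Connectivity of the comparison digraph *)

(** One direction of crossing suffices: taking [~: S] for [S] yields the other. *)
Definition strongly_linked (n : nat) (W : 'I_n -> 'I_n -> nat) : Prop :=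
  forall S : {set 'I_n}, S != finset.set0 -> ~: S != finset.set0 ->
    exists i j, [/\ i \in S, j \in ~: S & (0 < W i j)%N].

Lemma strongly_linked_gap_bound (R : realFieldType) (n : nat)
    (W : 'I_n.+1 -> 'I_n.+1 -> nat) (m : 'I_n.+1 -> R) (D : R) :
    strongly_linked W -> 0 <= D ->
    (forall i j, i != j -> (0 < W i j)%N -> - D <= m i - m j) ->
  forall i j, - (D * n%:R) <= m i - m j.
Proof.
move=> hW D0 hm i j.
pose e := [rel i j | (i != j) && (0 < W i j)%N].
have path_gap p k : path e k p -> - (D * (size p)%:R) <= m k - m (last k p).
  elim: p k => [|l p IH] k /=; first by rewrite mulr0 oppr0 subrr.
  case/andP=> /andP[kl Wkl] /IH; rewrite -natr1 mulrDr mulr1.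
  by have := hm _ _ kl Wkl; lra.
have : connect e i j.
  (* The set reachable from [i] would be a cut with no outgoing edge. *)
  apply/negPn/negP => nij.
  have [||k [l []]] := hW [set k | connect e i k].
  - by apply/set0Pn; exists i; rewrite inE connect0.
  - by apply/set0Pn; exists j; rewrite !inE.
  rewrite !inE => ik nil Wkl; case/negP: nil.
  apply: connect_trans ik _; case: (eqVneq k l) => [->|kl]; first exact: connect0.
  by apply: connect1; rewrite /= kl.
(* A path without repetition among [n.+1] vertices has at most [n] edges, each costing at most
   [D]. *)
case/connectP => p /shortenP[q eq uq _] ->.
apply: le_trans (path_gap _ _ eq); rewrite lerN2 ler_wpM2l// ler_nat.
by have := max_card (mem (i :: q)); rewrite (card_uniqP uq) card_ord.
Qed.

(** * The likelihood as a product over ordered pairs *)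

Lemma likelihood_pairE (R : realType) (F : R -> R) (n : nat)
    (W : 'I_n -> 'I_n -> nat) (m : 'rV[R]_n) :
  likelihood F W m = \prod_(p : 'I_n * 'I_n | p.1 != p.2)
    F (m ord0 p.1 - m ord0 p.2) ^+ W p.1 p.2.
Proof. by rewrite /likelihood pair_big_dep. Qed.

Section Likelihood.
Variables (R : realType) (F : R -> R) (n : nat) (W : 'I_n -> 'I_n -> nat).
Hypothesis F01 : forall x, 0 < F x < 1.

Lemma likelihood_gt0 (m : 'rV[R]_n) : 0 < likelihood F W m.
Proof.
rewrite likelihood_pairE prodr_gt0// => p _.
by apply: exprn_gt0; case/andP: (F01 (m ord0 p.1 - m ord0 p.2)).
Qed.

Lemma likelihood_le_factor (m : 'rV[R]_n) (i j : 'I_n) :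
  i != j -> (0 < W i j)%N -> likelihood F W m <= F (m ord0 i - m ord0 j).
Proof.
move=> ij Wij; rewrite likelihood_pairE (bigD1 (i, j))//=.
have FX x k : 0 <= F x ^+ k <= 1.
  have /andP[Fx0 Fx1] := F01 x.
  by rewrite exprn_ge0 ?exprn_ile1// ltW.
have /andP[Fx0 Fx1] := F01 (m ord0 i - m ord0 j).
apply: (@le_trans _ _ (F (m ord0 i - m ord0 j) ^+ W i j)).
  rewrite ler_piMr//; first by case/andP: (FX (m ord0 i - m ord0 j) (W i j)).
  by apply: prodr_ile1 => p _.
by rewrite ler_iXnr// ltW.
Qed.

Lemma continuous_likelihood : continuous F -> continuous (likelihood F W).
Proof.
move=> cF.
rewrite (_ : likelihood F W = fun m => \prod_(p : 'I_n * 'I_n | p.1 != p.2)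
    F (m ord0 p.1 - m ord0 p.2) ^+ W p.1 p.2); last first.
  by apply/funext => m; exact: likelihood_pairE.
apply: continuous_big; first exact: mul_continuous.
move=> p _ m.
apply: (@continuous_comp _ _ _ (fun m : 'rV[R]_n => F (m ord0 p.1 - m ord0 p.2))
  (fun x => x ^+ W p.1 p.2)); last exact: exprn_continuous.
apply: (@continuous_comp _ _ _ (fun m : 'rV[R]_n => m ord0 p.1 - m ord0 p.2) F);
  last exact: cF.
by apply: continuousB; exact: coord_continuous.
Qed.

(** Strict midpoint concavity of [log L] in multiplicative form: factors are compared one by one,
    and the pair [(i, j)] supplies the strictness. *)
Lemma likelihood_midpoint_lt (m m' : 'rV[R]_n) (i j : 'I_n) :
    (forall z h, 0 < h -> F (z - h) * F (z + h) < F z ^+ 2) ->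
    i != j -> (0 < W i j)%N ->
    m ord0 i - m ord0 j != m' ord0 i - m' ord0 j ->
  likelihood F W m * likelihood F W m' <
    likelihood F W (2^-1 *: (m + m')) ^+ 2.
Proof.
move=> logc ij Wij dneq.
have mid_lt x y : x != y -> F x * F y < F (2^-1 * (x + y)) ^+ 2.
  wlog xy : x y / x < y => [hw neq|_].
    have [xy|yx|/eqP] := ltgtP x y; [exact: hw| |by rewrite (negPf neq)].
    by rewrite mulrC addrC; apply: hw => //; rewrite eq_sym.
  have h0 : 0 < 2^-1 * (y - x) by lra.
  have xE : 2^-1 * (x + y) - 2^-1 * (y - x) = x by lra.
  have yE : 2^-1 * (x + y) + 2^-1 * (y - x) = y by lra.
  by have := logc (2^-1 * (x + y)) _ h0; rewrite xE yE.
have mid_le x y : F x * F y <= F (2^-1 * (x + y)) ^+ 2.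
  have [->|/mid_lt/ltW//] := eqVneq x y.
  by rewrite (_ : 2^-1 * (y + y) = y) -?expr2//; lra.
have midE (p : 'I_n * 'I_n) : (2^-1 *: (m + m')) ord0 p.1 -
    (2^-1 *: (m + m')) ord0 p.2 =
    2^-1 * ((m ord0 p.1 - m ord0 p.2) + (m' ord0 p.1 - m' ord0 p.2)).
  by rewrite !mxE; lra.
have Fge0 x : 0 <= F x by case/andP: (F01 x) => /ltW.
rewrite !likelihood_pairE -prodrXl -big_split/= [ltLHS](bigD1 (i, j))//=.
rewrite [ltRHS](bigD1 (i, j))//=.
under [in ltLHS]eq_bigr do rewrite -exprMn.
under [in ltRHS]eq_bigr do rewrite midE exprAC.
rewrite -exprMn (midE (i, j)) exprAC/=.
apply: (@lt_le_trans _ _ ((F (2^-1 * (m ord0 i - m ord0 j +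
    (m' ord0 i - m' ord0 j))) ^+ 2) ^+ W i j * \prod_(p | (p.1 != p.2) && (p != (i, j)))
    (F (m ord0 p.1 - m ord0 p.2) * F (m' ord0 p.1 - m' ord0 p.2)) ^+ W p.1 p.2)).
  rewrite ltr_pM2r; last first.
    apply: prodr_gt0 => p _; apply: exprn_gt0; apply: mulr_gt0.
      by case/andP: (F01 (m ord0 p.1 - m ord0 p.2)).
    by case/andP: (F01 (m' ord0 p.1 - m' ord0 p.2)).
  by rewrite ltrXn2r ?mulr_ge0 ?mid_lt// -lt0n.
apply: ler_wpM2l; first by rewrite !exprn_ge0.
apply: ler_prod => p _; rewrite exprn_ge0 ?mulr_ge0//=.
by apply: lerXn2r; rewrite ?nnegrE ?exprn_ge0 ?mulr_ge0.
Qed.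

End Likelihood.

(** * Existence, uniqueness and necessity of the cut condition *)

Lemma likelihood_maximizer_exists (R : realType) (F : R -> R) (n : nat)
    (W : 'I_n.+1 -> 'I_n.+1 -> nat) :
    cdf_class F -> strongly_linked W ->
  exists m : 'rV[R]_n.+1, is_likelihood_maximizer F W m.
Proof.
move=> hF hW.
have cF : continuous F.
  move=> x; apply: differentiable_continuous; apply/derivable1_diffP.
  exact: cdf_class_derivable.
have Flt := cdf_class_homo_lt hF.
have nearNy := cdf_class_nearNy hF.
have F01 : forall x, 0 < F x < 1 by case: hF.
have L0 := likelihood_gt0 W F01 0.
(* A linked gap below [x] would give [L m < L 0], since [L] is at most each of its linked
   factors. *)
have [x Fx] := nearNy _ L0.
pose D := `|x|; pose K := D * n%:R.
have D0 : 0 <= D by exact: normr_ge0.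
have K0 : 0 <= K by rewrite mulr_ge0.
have bnd (m : 'rV[R]_n.+1) : likelihood F W 0 <= likelihood F W m ->
    forall i j, - K <= m ord0 i - m ord0 j.
  move=> Lm; apply: (strongly_linked_gap_bound hW D0) => i j ij Wij.
  rewrite leNgt; apply/negP => gap.
  have /Flt : m ord0 i - m ord0 j < x.
    by apply: lt_le_trans gap _; rewrite lerNl /D -normrN ler_norm.
  by have := likelihood_le_factor F01 m ij Wij; lra.
(* The degenerate first interval builds the normalization into the compact box. *)
pose A (i : 'I_n.+1) : set R :=
  if i == ord0 then `[0, 0]%classic else `[- K, K]%classic.
pose B := [set m : 'rV[R]_n.+1 | forall i, A i (m ord0 i)]%classic.
have B0 : B 0.
  by move=> i; rewrite /A mxE; case: ifP => _ /=; rewrite in_itv/= ?lexx ?oppr_le0 ?K0.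
have cB : compact B.
  by apply: rV_compact => i; rewrite /A; case: ifP => _; exact: segment_compact.
have cL : {within B, continuous (likelihood F W)}%classic.
  exact/continuous_subspaceT/continuous_likelihood.
have [m /set_mem mB mmax] := EVT_max_rV (ex_intro _ _ B0) cB cL.
exists m; split.
  by have := mB ord0; rewrite /A eqxx /= in_itv/= -eq_le => /eqP.
move=> m' m'0; have [L0m'|/ltW Lm'0] := leP (likelihood F W 0) (likelihood F W m').
  apply: mmax; apply/mem_set => i; rewrite /A; case: ifP => [/eqP->|_].
    by rewrite m'0 /= in_itv/= lexx.
  have := bnd _ L0m' i ord0; have := bnd _ L0m' ord0 i.
  by rewrite m'0 /= in_itv/= => ? ?; apply/andP; split; lra.
by apply: le_trans Lm'0 _; apply: mmax; apply/mem_set.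
Qed.

Lemma likelihood_maximizer_unique (R : realType) (F : R -> R) (n : nat)
    (W : 'I_n.+1 -> 'I_n.+1 -> nat) (m m' : 'rV[R]_n.+1) :
    cdf_class F -> strongly_linked W ->
    is_likelihood_maximizer F W m -> is_likelihood_maximizer F W m' ->
  m = m'.
Proof.
move=> hF hW [m0 mmax] [m'0 m'max].
have F01 : forall x, 0 < F x < 1 by case: hF.
have logc z h : 0 < h -> F (z - h) * F (z + h) < F z ^+ 2.
  exact: cdf_class_log_concave.
have gapE i j : i != j -> (0 < W i j)%N ->
    m ord0 i - m ord0 j = m' ord0 i - m' ord0 j.
  move=> ij Wij; apply/eqP/negPn/negP => gap.
  have := likelihood_midpoint_lt F01 logc ij Wij gap.
  have Lm := mmax _ m'0; have Lm' := m'max _ m0.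
  have -> : likelihood F W m' = likelihood F W m by apply/le_anti/andP.
  apply/negP; rewrite -leNgt -expr2 lerXn2r ?nnegrE ?(ltW (likelihood_gt0 _ _ _))//.
  by apply: mmax; rewrite !mxE m0 m'0 addr0 mulr0.
(* Agreement starts at [ord0] and passes along any linked pair leaving [S], so [S] cannot be
   proper. *)
pose S := [set i | m ord0 i == m' ord0 i].
apply/rowP => i; apply/eqP/negPn/negP => neq.
have [||k [l []]] := hW S.
- by apply/set0Pn; exists ord0; rewrite inE m0 m'0.
- by apply/set0Pn; exists i; rewrite !inE.
rewrite !inE => /eqP kE lneq Wkl; case/negP: lneq.
have [kl|kl] := eqVneq k l; first by rewrite -kl kE.
by have := gapE _ _ kl Wkl; rewrite kE => /addrI/oppr_inj->.
Qed.

Lemma unique_maximizer_strongly_linked (R : realType) (F : R -> R) (n : nat)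
    (W : 'I_n.+1 -> 'I_n.+1 -> nat) :
    cdf_class F -> (exists! m : 'rV[R]_n.+1, is_likelihood_maximizer F W m) ->
  strongly_linked W.
Proof.
move=> hF [m [[m0 mmax] muniq]] S /set0Pn[a aS] /set0Pn[b bS].
have [//|noW] := pselect (exists i j, [/\ i \in S, j \in ~: S & (0 < W i j)%N]).
have Fle := ltW_homo (cdf_class_homo_lt hF).
have F01 : forall x, 0 < F x < 1 by case: hF.
(* The block [S] is lowered by 1; the common shift restores the first coordinate to 0 and leaves all
   gaps unaffected. *)
pose m' : 'rV[R]_n.+1 :=
  \row_i (m ord0 i - (i \in S)%:R + (ord0 \in S)%:R).
have m'0 : m' ord0 ord0 = 0 by rewrite mxE m0 sub0r addNr.
have LmLm' : likelihood F W m <= likelihood F W m'.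
  rewrite !likelihood_pairE; apply: ler_prod => -[i j] /= _.
  have [->|] := posnP (W i j); first by rewrite !expr0 ler01 lexx.
  move=> Wij; have F0 x : 0 <= F x by case/andP: (F01 x) => /ltW.
  rewrite exprn_ge0//= lerXn2r ?nnegrE ?F0//; apply: Fle.
  (* Only gaps from [S] to its complement shrink, and those carry exponent 0. *)
  have : (i \in S)%:R <= (j \in S)%:R :> R.
    rewrite ler_nat; case: (boolP (i \in S)) => // iS.
    case: (boolP (j \in S)) => // jS; case: noW.
    by exists i, j; rewrite iS inE jS.
  by rewrite !mxE; lra.
have mE : m = m'.
  by apply: muniq; split => // m'' m''0; apply: le_trans LmLm'; exact: mmax.
have /= := congr1 (fun v : 'rV[R]_n.+1 => v ord0 a - v ord0 b) mE.
by move: bS; rewrite inE !mxE aS => /negPf-> /=; lra.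
Qed.

Theorem theorem1 (R : realType) (F : R -> R) (hF : cdf_class F) (n : nat)
    (W : 'I_n.+1 -> 'I_n.+1 -> nat) :
  (exists! m : 'rV[R]_n.+1, is_likelihood_maximizer F W m) <->
  (forall S : {set 'I_n.+1}, S != finset.set0 -> ~: S != finset.set0 ->
     (exists i j : 'I_n.+1, [/\ i \in S, j \in ~: S & (0 < W i j)%N]) /\
     (exists i' j' : 'I_n.+1, [/\ i' \in S, j' \in ~: S & (0 < W j' i')%N])).
Proof.
split=> [/(unique_maximizer_strongly_linked hF) hW S S0 SC0|hW].
  split; first exact: hW.
  have [||j [i [jS iS Wji]]] := hW (~: S) => //; first by rewrite finset.setCK.
  by exists i, j; rewrite finset.setCK in iS.
have {}hW : strongly_linked W by move=> S S0 /(hW _ S0)[].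
have [m mP] := likelihood_maximizer_exists hF hW.
by exists m; split => // m'; exact: likelihood_maximizer_unique.
Qed.
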